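(* Every visual Gromov hyperbolic metric space is roughly similar to some asymptotically $\mathrm{PT}_{-1}$ metric space.
   Context: **Asymptotically $\mathrm{PT}_{-1}$.** A metric space $(X,d)$ is asymptotically $\mathrm{PT}_{-1}$ if there exists $\delta>0$ such that for all $x_1,x_2,x_3,x_4\in X$, with $\rho_{i,j}=d(x_i,x_j)$ and $\rho=\max_{i,j}\rho_{i,j}$, $$e^{\frac12(\rho_{1,3}+\rho_{2,4})}\le e^{\frac12(\rho_{1,2}+\rho_{3,4})}+e^{\frac12(\rho_{1,4}+\rho_{2,3})}+\delta e^{\frac12\rho}.$$ **Gromov hyperbolic, visual.** $X$ is Gromov hyperbolic if there is $\delta>0$ with $\rho_{1,3}+\rho_{2,4}\le\max\{\rho_{1,2}+\rho_{3,4},\rho_{1,4}+\rho_{2,3}\}+\delta$ for all quadruples. The Gromov product is $(x|y)_o=\frac12(d(o,x)+d(o,y)-d(x,y))$. A sequence $(x_i)$ converges at infinity if $\lim_{i,j\to\infty}(x_i|x_j)_o=\infty$ for some (hence every) $o\in X$; two such sequences are equivalent if $\lim_i(x_i|y_i)_o=\infty$; $\partial_\infty X$ is the set of equivalence classes. For $x\in X$, $\xi\in\partial_\infty X$, $(x|\xi)_o=\inf\liminf_i(x|y_i)_o$, infimum over $(y_i)\in\xi$. A Gromov hyperbolic space $X$ is visual if for some base point $o\in X$ there is $D\ge0$ such that for every $x\in X$ there is $\xi\in\partial_\infty X$ with $d(o,x)\le D+(x|\xi)_o$. **Rough similarity.** Metric spaces $X$ and $Y$ are roughly similar if there are constants $K,\lambda>0$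 and a map $f:X\to Y$ such that $|\lambda d_X(x,y)-d_Y(f(x),f(y))|\le K$ for all $x,y\in X$ and $\sup_{y\in Y}d_Y(y,f(X))\le K$. *)

(* Defs.v *)
From mathcomp Require Import all_boot all_order all_algebra.
From mathcomp Require Import all_classical all_reals all_analysis.

Set Implicit Arguments.
Unset Strict Implicit.
Unset Printing Implicit Defensive.

Import Order.TTheory GRing.Theory Num.Theory.
Import numFieldNormedType.Exports.

Local Open Scope classical_set_scope.
Local Open Scope ring_scope.

Section MetricNotions.
Context {R : realType}.

Section OneSpace.
Context (X : metricType R).
Implicit Types o x y : X.

(* The maximum over all pairs (i, j) reduces to the six pairs with i < j,
   by symmetry and nonnegativity of the distance. *)
Definition diam4 (x1 x2 x3 x4 : X) : R :=
  Num.max (mdist x1 x2) (Num.max (mdist x1 x3) (Num.max (mdist x1 x4)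
    (Num.max (mdist x2 x3) (Num.max (mdist x2 x4) (mdist x3 x4))))).

Definition asymptotically_PT_m1 : Prop :=
  exists2 delta : R, 0 < delta &
    forall x1 x2 x3 x4 : X,
      expR (2^-1 * (mdist x1 x3 + mdist x2 x4)) <=
        expR (2^-1 * (mdist x1 x2 + mdist x3 x4)) +
        expR (2^-1 * (mdist x1 x4 + mdist x2 x3)) +
        delta * expR (2^-1 * diam4 x1 x2 x3 x4).

Definition gromov_hyperbolic : Prop :=
  exists2 delta : R, 0 < delta &
    forall x1 x2 x3 x4 : X,
      mdist x1 x3 + mdist x2 x4 <=
        Num.max (mdist x1 x2 + mdist x3 x4) (mdist x1 x4 + mdist x2 x3) + delta.

Definition gromov_product o x y : R :=
  2^-1 * (mdist o x + mdist o y - mdist x y).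

Definition converges_at_infinity (u : nat -> X) : Prop :=
  exists o, gromov_product o (u ij.1) (u ij.2) @[ij --> (\oo, \oo)] --> +oo.

Definition equivalent_at_infinity (u v : nat -> X) : Prop :=
  exists o, gromov_product o (u i) (v i) @[i --> \oo] --> +oo.

(* Points at infinity are represented by the equivalence classes themselves,
   as sets of sequences. *)
Definition boundary_at_infinity : set (set (nat -> X)) :=
  [set [set v | converges_at_infinity v /\ equivalent_at_infinity u v]
    | u in [set u | converges_at_infinity u]].

Definition gromov_product_bdry o x (xi : set (nat -> X)) : \bar R :=
  ereal_inf [set limn_einf (fun i => (gromov_product o x (v i))%:E) | v in xi].

Definition visual : Prop :=
  exists o, exists2 D : R, 0 <= D &
    forall x, exists2 xi, boundary_at_infinity xi &
      ((mdist o x)%:E <= D%:E + gromov_product_bdry o x xi)%E.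

(* Equal to +oo when A is empty. *)
Definition dist_to_set x (A : set X) : \bar R :=
  ereal_inf [set (mdist x a)%:E | a in A].

End OneSpace.

Definition roughly_similar (X Y : metricType R) : Prop :=
  exists K lambda : R, exists f : X -> Y,
    [/\ 0 < K, 0 < lambda,
        forall x y : X, `|lambda * mdist x y - mdist (f x) (f y)| <= K &
        (ereal_sup [set dist_to_set y (range f) | y in [set: Y]] <= K%:E)%E].

End MetricNotions.

(* Main.v *)
From HB Require Import structures.
Require Import Defs.
From mathcomp Require Import all_boot all_order all_algebra.
From mathcomp Require Import all_classical all_reals all_analysis.
From mathcomp Require Import ring lra.

(** Fix a base point [o] and write [|x|] for the distance from [o] to [x]. By
    hyperbolicity, for a suitable [ep > 0] the function
      [q x y = exp (- ep * (x|y)_o)]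
    satisfies [q x z <= K * max (q x y) (q y z)] with [K ^ 2 <= 2]. Frink's
    metrization argument then applies: the infimum [D x y] of the sums of [q]
    along chains from [x] to [y] satisfies the triangle inequality and
    [q / 2 <= D <= q] ([chain_dist_ge], [chain_dist_le]). The function [D] is
    not a metric, since [D x x > 0]; in fact [D x y >= exp (- ep * |x|) / 2].

    With [t x = - ep * |x| - ln 4], the desired space is [X] itself with the
    distance [rho x y = ln (D x y) - (t x + t y) / 2] for [x <> y] and
    [rho x x = 0]. This is a hyperbolic cone metric on [X], the point [x] being
    placed at height [exp (t x)].
    - Since [D x y >= 2 * exp (t x)], the triangle inequality for [D] gives
      [D x z * exp (t y) <= D x y * D y z], that is, the triangle inequality
      for [rho] ([log_dist_triangle]).
    - For four distinct points, [exp (rho x y / 2)] is [sqrt (D x y)] times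
      [exp (- (t x + t y) / 4)], and these last factors have the same product in
      all three terms of the PT inequality. What remains is the Ptolemy
      inequality for [sqrt D], which holds for the square root of any positive
      symmetric function satisfying the triangle inequality
      ([ptolemy_of_sqr_triangle]). When two of the points coincide, the triangle
      inequality for [rho] is enough. Hence the PT inequality holds for [rho]
      without any error term ([log_dist_PT]).
    - Up to a bounded error [ln (D x y)] is [- ep * (x|y)_o], so [rho] is within
      [ln 4] of [ep / 2] times the distance of [X]: the identity is a rough
      similarity. *)

Import Order.TTheory GRing.Theory Num.Theory.
Local Open Scope classical_set_scope.
Local Open Scope ring_scope.

(** * The Ptolemy inequality for square roots of distances *)

(** For a quadrilateral with sides [a, b, c, e] and diagonals [p, r], whose
    squares satisfy the triangle inequality. Weighing the two bounds on [p ^ 2]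
    by [c * e] and [a * b] gives
      [p ^ 2 * (a * b + c * e) <= (a * c + b * e) * (a * e + b * c)],
    and similarly for [r]; the product of these two bounds is the square of the
    claim. The bounds are those given by Brahmagupta's formulas for the
    diagonals of the cyclic quadrilateral with the same sides. *)
Lemma ptolemy_of_sqr_triangle (R : realFieldType) (a b c e p r : R) :
  0 < a -> 0 < b -> 0 < c -> 0 < e -> 0 <= p -> 0 <= r ->
  p ^+ 2 <= a ^+ 2 + b ^+ 2 -> p ^+ 2 <= c ^+ 2 + e ^+ 2 ->
  r ^+ 2 <= a ^+ 2 + e ^+ 2 -> r ^+ 2 <= b ^+ 2 + c ^+ 2 ->
  p * r <= a * c + b * e.
Proof.
move=> a0 b0 c0 e0 p0 r0 pab pce rae rbc.
have ab0 := mulr_gt0 a0 b0; have ce0 := mulr_gt0 c0 e0.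
have ae0 := mulr_gt0 a0 e0; have bc0 := mulr_gt0 b0 c0.
have hp : p ^+ 2 * (a * b + c * e) <= (a * c + b * e) * (a * e + b * c).
  have := ler_wpM2r (ltW ce0) pab; have := ler_wpM2r (ltW ab0) pce; lra.
have hr : r ^+ 2 * (a * e + b * c) <= (a * c + b * e) * (a * b + c * e).
  have := ler_wpM2r (ltW bc0) rae; have := ler_wpM2r (ltW ae0) rbc; lra.
suff : (p * r) ^+ 2 <= (a * c + b * e) ^+ 2.
  rewrite ler_pXn2r // nnegrE; first exact: mulr_ge0.
  by rewrite addr_ge0 // mulr_ge0 // ltW.
have W0 : 0 < (a * b + c * e) * (a * e + b * c) by rewrite mulr_gt0 ?addr_gt0.
rewrite -(ler_pM2r W0).
have -> : (p * r) ^+ 2 * ((a * b + c * e) * (a * e + b * c)) =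
  (p ^+ 2 * (a * b + c * e)) * (r ^+ 2 * (a * e + b * c)) by ring.
have -> : (a * c + b * e) ^+ 2 * ((a * b + c * e) * (a * e + b * c)) =
  ((a * c + b * e) * (a * e + b * c)) * ((a * c + b * e) * (a * b + c * e)).
  by ring.
by apply: ler_pM => //; apply: mulr_ge0; rewrite ?sqr_ge0 ?addr_ge0 ?ltW.
Qed.

(** * Chain metrization of a quasi-ultrametric *)

Section Chains.
Context {R : realType} {T : Type} (q : T -> T -> R).

(** The sum of [q] over the consecutive points of the chain [x :: s]. *)
Fixpoint chain_cost (x : T) (s : seq T) : R :=
  if s is y :: s' then q x y + chain_cost y s' else 0.

(** The infimum of the costs of the chains from [x] to [y]; the intermediate
    points [s] are arbitrary, and may be absent. *)
Definition chain_dist (x y : T) : R :=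
  inf (range (fun s => chain_cost x (rcons s y))).

Lemma chain_cost_cat x s1 s2 :
  chain_cost x (s1 ++ s2) = chain_cost x s1 + chain_cost (last x s1) s2.
Proof. by elim: s1 x => [|y s1 IH] x /=; rewrite ?add0r // IH addrA. Qed.

Hypothesis q_gt0 : forall x y, 0 < q x y.
Hypothesis q_sym : forall x y, q x y = q y x.

Lemma chain_cost_ge0 x s : 0 <= chain_cost x s.
Proof. by elim: s x => [|y s IH] x //=; rewrite addr_ge0 // ltW. Qed.

Lemma chain_cost_rev x s y :
  chain_cost x (rcons s y) = chain_cost y (rcons (rev s) x).
Proof.
elim: s x => [|z s IH] x /=; first by rewrite q_sym.
rewrite IH rev_cons -!cats1 !chain_cost_cat /= !last_cat /= (q_sym x).
by rewrite !addr0 addrC.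
Qed.

(** The chain [x :: s] is cut at the edge where its partial sums exceed [t]. *)
Lemma chain_split x s (t : R) : 0 <= t -> t < chain_cost x s ->
  exists s1 y s2, [/\ s = s1 ++ y :: s2, chain_cost x s1 <= t &
    t < chain_cost x s1 + q (last x s1) y].
Proof.
elim: s x t => [|y s IH] x t t0 /=; first by move=> /(le_lt_trans t0); rewrite ltxx.
case: (ltP t (q x y)) => [tq _|qt tc].
  by exists [::], y, s; split; rewrite //= add0r.
have [||s1 [z [s2 [-> h1 h2]]]] := IH y (t - q x y); [lra|lra|].
by exists (y :: s1), z, s2; split => //=; lra.
Qed.

Section Frink.
Variable K : R.
Hypothesis K1 : 1 <= K.
Hypothesis K2 : K * K <= 2.
Hypothesis q_loop : forall x y, q x x <= q x y.
Hypothesis q_quasi : forall x y z, q x z <= K * Num.max (q x y) (q y z).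

(** Frink's lemma. The chain is cut at the edge where its partial sums exceed
    half of the total cost [S]. By induction the part before that edge, the edge
    and the part after it each join points at [q]-distance at most [S], so two
    uses of the quasi-ultrametric inequality bound [q] between the ends by
    [K ^ 2 * S <= 2 * S]. *)
Lemma chain_cost_ge x s : s <> [::] -> q x (last x s) <= 2 * chain_cost x s.
Proof.
have [n] := ubnP (size s).
elim: n x s => // n IH x s; rewrite ltnS => ssz s0; set S := chain_cost x s.
have S0 : 0 < S.
  rewrite /S; case: s s0 {ssz S} => [//|y s _] /=.
  by rewrite ltr_wpDr ?chain_cost_ge0.
have [||s1 [y [s2 [es h1 h2]]]] := @chain_split x s (S / 2); [lra|rewrite -/S; lra|].
have eS : S = chain_cost x s1 + (q (last x s1) y + chain_cost y s2).
  by rewrite /S es chain_cost_cat.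
have c1 := chain_cost_ge0 x s1; have c2 := chain_cost_ge0 y s2.
have qxy : q (last x s1) y <= S by lra.
have q1 : q x (last x s1) <= S.
  (* An empty part is covered by [q_loop], because [q x x] need not vanish. *)
  case: s1 es h1 h2 eS c1 qxy => [|z s1] es h1 h2 eS c1 qxy.
    exact: le_trans (q_loop _ _) qxy.
  have h : (size (z :: s1) < n)%N.
    by move: ssz; rewrite es size_cat /= addnS; apply: leq_trans; rewrite ltnS leq_addr.
  by have := IH x (z :: s1) h ltac:(by []); lra.
have q2 : q y (last y s2) <= S.
  case: s2 es eS c2 => [|z s2] es eS c2.
    by rewrite /= (le_trans (q_loop _ (last x s1)))// q_sym.
  have h : (size (z :: s2) < n)%N.
    by move: ssz; rewrite es size_cat; apply: leq_trans; rewrite leq_addl.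
  by have := IH y (z :: s2) h ltac:(by []); lra.
have -> : last x s = last y s2 by rewrite es last_cat.
have K0 : 0 <= K by apply: le_trans K1.
have SKS : S <= K * S by rewrite ler_peMl // ltW.
have q3 : q x y <= K * S.
  apply: le_trans (q_quasi _ (last x s1) _) _.
  by rewrite ler_wpM2l // ge_max q1 qxy.
apply: (le_trans (q_quasi _ y _)).
apply: (@le_trans _ _ (K * (K * S))).
  by rewrite ler_wpM2l // ge_max q3 (le_trans q2).
by rewrite mulrA ler_wpM2r // ltW.
Qed.

Lemma chain_dist_ge x y : q x y / 2 <= chain_dist x y.
Proof.
apply: lb_le_inf; first by exists (chain_cost x (rcons [::] y)); exists [::].
move=> _ [s _ <-].
have := @chain_cost_ge x (rcons s y); rewrite last_rcons.
have h : rcons s y <> [::] by case: s.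
by move=> /(_ h); lra.
Qed.

End Frink.

Let chain_lbound x y : has_lbound (range (fun s => chain_cost x (rcons s y))).
Proof. by exists 0 => _ [s _ <-]; exact: chain_cost_ge0. Qed.

Lemma chain_dist_le x y : chain_dist x y <= q x y.
Proof. by apply: ge_inf => //; exists [::] => //=; exact: addr0. Qed.

Lemma chain_dist_sym x y : chain_dist x y = chain_dist y x.
Proof.
rewrite /chain_dist; congr inf; apply/seteqP; split => _ [s _ <-];
  by exists (rev s) => //; rewrite -chain_cost_rev.
Qed.

Lemma chain_dist_triangle x y z :
  chain_dist x z <= chain_dist x y + chain_dist y z.
Proof.
rewrite -lerBlDr; apply: lb_le_inf.
  by exists (chain_cost x (rcons [::] y)); exists [::].
move=> _ [s _ <-]; rewrite lerBlDr -lerBlDl; apply: lb_le_inf.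
  by exists (chain_cost y (rcons [::] z)); exists [::].
move=> _ [s' _ <-]; rewrite lerBlDl; apply: ge_inf => //.
exists (s ++ y :: s') => //.
by rewrite -cat_rcons rcons_cat chain_cost_cat last_rcons.
Qed.

End Chains.

(** * The hyperbolic cone metric *)

(** A copy of [T], so that the metric [rho] can be put on a type which may
    already carry another one. *)
Definition renormed {R : realType} {T : choiceType} (rho : T -> T -> R) : Type := T.

HB.instance Definition _ (R : realType) (T : choiceType) (rho : T -> T -> R) :=
  Choice.on (renormed rho).

Lemma metricType_of_distance (R : realType) (T : choiceType) (rho : T -> T -> R) :
  (forall x, rho x x = 0) -> (forall x y, rho x y = 0 -> x = y) ->
  (forall x y, rho x y = rho y x) ->
  (forall y x z, rho x z <= rho x y + rho y z) ->
  exists (Y : metricType R) (f : T -> Y), [/\ forall x y, mdist (f x) (f y) = rho x y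
   & forall y, exists x, y = f x].
Proof.
move=> h1 h2 h3 h4.
pose Y : metricType R := HB.pack (renormed rho)
  (@isMetric.Build R (renormed rho) rho h1 h2 h3 h4).
by exists Y, id; split => // y; exists y.
Qed.

(** In this section [D] satisfies the triangle inequality without vanishing on
    the diagonal, and [expR (t x)] is the height of [x]. *)
Section LogRatio.
Context {R : realType} {T : choiceType} (D : T -> T -> R) (t : T -> R).

(** The value at [x = y] is imposed: the formula of the second branch would be
    positive there. *)
Definition log_dist (x y : T) : R :=
  if x == y then 0 else ln (D x y) - 2^-1 * (t x + t y).

Hypothesis D_sym : forall x y, D x y = D y x.
Hypothesis D_triangle : forall y x z, D x z <= D x y + D y z.
Hypothesis D_ge : forall x y, 2 * expR (t x) <= D x y.

Let D_gt0 x y : 0 < D x y.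
Proof. by apply: lt_le_trans (D_ge x y); rewrite mulr_gt0 ?expR_gt0. Qed.

Lemma log_distxx x : log_dist x x = 0.
Proof. by rewrite /log_dist eqxx. Qed.

Lemma log_dist_sym x y : log_dist x y = log_dist y x.
Proof. by rewrite /log_dist eq_sym D_sym (addrC (t x)). Qed.

Lemma log_dist_gt0 x y : x != y -> 0 < log_dist x y.
Proof.
move=> /negPf xy; rewrite /log_dist xy.
have lnD u v : ln 2 + t u <= ln (D u v).
  rewrite -ler_expR expRD !lnK ?posrE //; exact: D_ge.
have := lnD x y; have := lnD y x; rewrite (D_sym y).
have : 0 < ln 2 :> R by rewrite ln_gt0 // ltr1n.
lra.
Qed.

Lemma log_dist_eq0 x y : log_dist x y = 0 -> x = y.
Proof.
by case: (eqVneq x y) => // /log_dist_gt0 /[swap] ->; rewrite ltxx.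
Qed.

Lemma log_dist_triangle y x z : log_dist x z <= log_dist x y + log_dist y z.
Proof.
have ge0 u v : 0 <= log_dist u v.
  by case: (eqVneq u v) => [->|/log_dist_gt0/ltW //]; rewrite log_distxx.
case: (eqVneq x z) => [->|xz]; first by rewrite log_distxx addr_ge0.
case: (eqVneq x y) => [<-|xy]; first by rewrite log_distxx add0r.
case: (eqVneq y z) => [->|yz]; first by rewrite log_distxx addr0.
rewrite /log_dist !(negPf xz) (negPf xy) (negPf yz).
suff : ln (D x z) + t y <= ln (D x y) + ln (D y z) by lra.
rewrite -ler_expR !expRD !lnK ?posrE //.
have h1 := D_ge y x; have h2 := D_ge y z; rewrite (D_sym y x) in h1.
have := expR_gt0 (t y); have := D_triangle y x z.
move: h1 h2; move: (expR _) (D x y) (D y z) (D x z) => e a b c h1 h2 h3 h4.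
have := ler_wpM2r (ltW h4) h3.
have : 0 <= (a - 2 * e) * b + (b - 2 * e) * a.
  by rewrite addr_ge0 // mulr_ge0 ?subr_ge0 //; nra.
nra.
Qed.

(** The PT inequality with no error term. *)
Lemma log_dist_PT x1 x2 x3 x4 :
  expR (2^-1 * (log_dist x1 x3 + log_dist x2 x4)) <=
  expR (2^-1 * (log_dist x1 x2 + log_dist x3 x4)) +
  expR (2^-1 * (log_dist x1 x4 + log_dist x2 x3)).
Proof.
have e0 (u v w : R) : u <= v -> expR (2^-1 * u) <= expR (2^-1 * v) + expR w.
  by move=> uv; rewrite ler_wpDr ?expR_ge0 // ler_expR; lra.
(* If [x1 = x3] or [x2 = x4] the claim follows from the triangle inequality; if
   two other points coincide, the left-hand side equals one of the terms on the
   right. *)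
case: (eqVneq x1 x2) => [<-|x12].
  by rewrite [leRHS]addrC; apply: e0; rewrite addrC.
case: (eqVneq x1 x3) => [<-|x13].
  apply: e0; rewrite log_distxx add0r (log_dist_sym x1 x2).
  exact: log_dist_triangle.
case: (eqVneq x1 x4) => [<-|x14].
  by apply: e0; rewrite addrC (log_dist_sym x2) (log_dist_sym x1 x3).
case: (eqVneq x2 x3) => [<-|x23]; first by apply: e0.
case: (eqVneq x2 x4) => [<-|x24].
  apply: e0; rewrite log_distxx addr0 (log_dist_sym x3).
  exact: log_dist_triangle.
case: (eqVneq x3 x4) => [<-|x34]; first by rewrite [leRHS]addrC; apply: e0.
pose g x y := expR (2^-1 * ln (D x y)); pose m := expR (- (4^-1 * (t x1 + t x2 + t x3 + t x4))).
have g2 x y : g x y ^+ 2 = D x y.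
  rewrite /g expr2 -expRD (_ : _ + _ = ln (D x y)) ?lnK ?posrE //; lra.
have g0 x y : 0 < g x y by exact: expR_gt0.
have -> : expR (2^-1 * (log_dist x1 x3 + log_dist x2 x4)) = g x1 x3 * g x2 x4 * m.
  by rewrite /log_dist (negPf x13) (negPf x24) -!expRD; congr expR; lra.
have -> : expR (2^-1 * (log_dist x1 x2 + log_dist x3 x4)) = g x1 x2 * g x3 x4 * m.
  by rewrite /log_dist (negPf x12) (negPf x34) -!expRD; congr expR; lra.
have -> : expR (2^-1 * (log_dist x1 x4 + log_dist x2 x3)) = g x1 x4 * g x2 x3 * m.
  by rewrite /log_dist (negPf x14) (negPf x23) -!expRD; congr expR; lra.
rewrite -mulrDl ler_wpM2r ?expR_ge0 // (mulrC (g x1 x4)).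
apply: ptolemy_of_sqr_triangle; rewrite ?(ltW (g0 _ _)) // !g2.
- exact: D_triangle.
- by rewrite addrC (D_sym x3 x4); exact: D_triangle.
- by rewrite (D_sym x1 x2); exact: D_triangle.
- exact: D_triangle.
Qed.

End LogRatio.

(** * Gromov products *)

Section GromovProduct.
Context {R : realType} {X : metricType R}.
Implicit Types o x y z : X.

Lemma gromov_productC o x y : gromov_product o x y = gromov_product o y x.
Proof. by rewrite /gromov_product (metric_sym x y) (addrC (mdist o x)). Qed.

Lemma gromov_productxx o x : gromov_product o x x = mdist o x.
Proof. rewrite /gromov_product mdistxx; lra. Qed.

Lemma gromov_product_le o x y : gromov_product o x y <= mdist o x.
Proof. by have := metric_triangle o x y; rewrite /gromov_product; lra. Qed.

Lemma gromov_product_ultra (delta : R) o x y z :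
  (forall x1 x2 x3 x4 : X,
      mdist x1 x3 + mdist x2 x4 <=
        Num.max (mdist x1 x2 + mdist x3 x4) (mdist x1 x4 + mdist x2 x3) + delta) ->
  Num.min (gromov_product o x y) (gromov_product o y z) - delta / 2 <=
    gromov_product o x z.
Proof.
move=> /(_ x y z o); rewrite (metric_sym y o) (metric_sym z o) (metric_sym x o).
rewrite -lerBlDr le_max => h; rewrite lerBlDr ge_min /gromov_product.
by case/orP: h => h; apply/orP; [left|right]; lra.
Qed.

End GromovProduct.

(** * Rough similarity with the cone metric *)

Theorem theorem1p4 (R : realType) (X : metricType R) :
  gromov_hyperbolic X -> visual X ->
  exists Y : metricType R, asymptotically_PT_m1 Y /\ roughly_similar X Y.
Proof.
move=> [delta delta0 hyp] [] o _.
have ln2 : 0 < ln 2 :> R by rewrite ln_gt0 // ltr1n.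
(* [ep] is chosen so that [K ^ 2 = 2] below. *)
pose ep : R := ln 2 / delta.
have ep0 : 0 < ep by rewrite divr_gt0.
have epd : ep * delta = ln 2 by rewrite divfK // gt_eqF.
pose q (x y : X) := expR (- (ep * gromov_product o x y)).
pose K := expR (ep * delta / 2).
have q_gt0 x y : 0 < q x y by exact: expR_gt0.
have q_sym x y : q x y = q y x by rewrite /q gromov_productC.
have q_loop x y : q x x <= q x y.
  by rewrite ler_expR lerN2 ler_wpM2l ?(ltW ep0) // gromov_productxx gromov_product_le.
have q_quasi x y z : q x z <= K * Num.max (q x y) (q y z).
  rewrite maxr_pMr ?expR_ge0 // /K /q -!expRD le_max !ler_expR.
  have := @gromov_product_ultra _ _ delta o x y z hyp.
  rewrite lerBlDr ge_min.
  by case/orP=> /(ler_wpM2l (ltW ep0)) h; apply/orP; [left|right]; lra.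
have K1 : 1 <= K by rewrite -expR0 ler_expR epd; lra.
have K2 : K * K <= 2.
  by rewrite -expRD -splitr epd lnK ?posrE.
pose t (x : X) := - (ep * mdist o x) - ln 4.
pose D := chain_dist q.
have D_ge x y : q x y / 2 <= D x y by exact: (@chain_dist_ge _ _ q q_gt0 q_sym K).
have D_le x y : D x y <= q x y by exact: chain_dist_le.
have D_sym x y : D x y = D y x by exact: chain_dist_sym.
have D_tri y x z : D x z <= D x y + D y z by exact: chain_dist_triangle.
have D_ge_height x y : 2 * expR (t x) <= D x y.
  apply: le_trans (D_ge _ _); have := q_loop x y.
  rewrite {1}/q gromov_productxx /t expRD (expRN (ln 4)) lnK ?posrE //.
  lra.
have [Y [f [fE fsurj]]] := @metricType_of_distance _ _ (log_dist D t)
  (@log_distxx _ _ D t) (@log_dist_eq0 _ _ D t D_sym D_ge_height)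
  (@log_dist_sym _ _ D t D_sym) (@log_dist_triangle _ _ D t D_sym D_tri D_ge_height).
have ln4 : 0 < ln 4 :> R by rewrite ln_gt0 // ltr1n.
exists Y; split.
  exists 1 => // y1 y2 y3 y4.
  have [[x1 ->] [x2 ->] [x3 ->] [x4 ->]] := And4 (fsurj y1) (fsurj y2) (fsurj y3) (fsurj y4).
  rewrite ler_wpDr ?mul1r ?expR_ge0 // !fE; exact: log_dist_PT.
(* [rho - (ep / 2) * d] is [ln D + ep * (x|y)_o + ln 4], between [ln 2] and
   [ln 4]. *)
exists (ln 4), (ep / 2), f; split => //.
- by rewrite divr_gt0.
- move=> x y; rewrite fE /log_dist; case: eqVneq => [->|xy].
    by rewrite mdistxx mulr0 subr0 normr0 ltW.
  have D0 : 0 < D x y by apply: lt_le_trans (D_ge x y); rewrite divr_gt0.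
  have l1 : ln (D x y) <= - (ep * gromov_product o x y).
    by rewrite -ler_expR lnK ?posrE // D_le.
  have l2 : - (ep * gromov_product o x y) - ln 2 <= ln (D x y).
    by rewrite -ler_expR expRD (expRN (ln 2)) !lnK ?posrE // D_ge.
  have e4 : ln 4 = ln 2 + ln 2 :> R by rewrite -lnM ?posrE // -natrM.
  by move: l1 l2; rewrite /t /gromov_product ler_norml; lra.
- apply: ge_ereal_sup => _ [y _ <-]; have [x ->] := fsurj y.
  apply: (@le_trans _ _ 0%E); last by rewrite lee_fin ltW.
  by apply: ereal_inf_lbound; exists (f x); [exists x|rewrite mdistxx].
Qed.
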